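(* Let $n\ge 1$. For integers $r\ge 2$ and $0\le k\le n$ define the polynomial $A^n_{r,k}(x)$ by \[\sum_{m\ge 0}(rm)^k(rm+1)^{n-k}x^m=\frac{A^n_{r,k}(x)}{(1-x)^{n+1}}.\] Suppose $p\in\mathbb{R}[x]$ satisfies $p(x)=\sum_{r\ge 2}\sum_{k=0}^n c_{r,k}A^n_{r,k}(x)$ for some nonnegative reals $c_{r,k}$, only finitely many nonzero. Then $\mathcal{I}_n(p)\prec p$; in particular, $p$ is real-rooted and alternatingly increasing.
   Context: $\mathcal{I}_n(p)(x)=x^np(1/x)$. Interlacing: the zeros of two real-rooted polynomials $p,q$ interlace if there is a zero of $p$ between each pair of zeros of $q$ (counted with multiplicity) and vice versa. We write $p\prec q$ if $p,q$ are real-rooted, their zeros interlace, and $p'q-pq'\le 0$ on $\mathbb{R}$; the zero polynomial is considered real-rooted and $0\prec p$, $p\prec 0$ for every real-rooted $p$. A polynomial $p=p_0+p_1x+\cdots+p_nx^n$ is alternatingly increasing if $0\le p_0\le p_n\le p_1\le p_{n-1}\le\cdots\le p_{\lfloor (n+1)/2\rfloor}$. *)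

(* Defs.v *)
From mathcomp Require Import all_boot all_order all_algebra.
From mathcomp Require Import reals polyrcf complex.
Set Implicit Arguments. Unset Strict Implicit. Unset Printing Implicit Defensive.
Import Order.TTheory GRing.Theory Num.Theory.
Local Open Scope ring_scope.

(* A formal power series over R is given by its sequence of coefficients. *)
Definition fps_mul (R : realType) (f g : nat -> R) (j : nat) : R :=
  \sum_(i < j.+1) f i * g (j - i)%N.

(* \sum_(m >= 0) a_m x^m = h(x) / (1 - x)^d in R[[x]], with the denominator
   cleared; (1 - x)^d is a unit of R[[x]], so h is unique. *)
Definition gf_numerator (R : realType) (a : nat -> R) (d : nat) (h : {poly R}) :=
  forall j : nat, fps_mul (fun i => ((1 - 'X) ^+ d)`_i) a j = h`_j.

(* A is A^n_{r,k}; for m = 0 and k = 0 the factor (r m)^k is 1. *)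
Definition is_A (R : realType) (n r k : nat) (A : {poly R}) :=
  gf_numerator
    (fun m => (r * m)%:R ^+ k * (r * m + 1)%:R ^+ (n - k)) n.+1 A.

(* x^n p(1/x) when deg p <= n, see inv_polyE. *)
Definition inv_poly (R : realType) (n : nat) (p : {poly R}) : {poly R} :=
  \poly_(i < n.+1) p`_(n - i).

Lemma inv_polyE (R : realType) (n : nat) (p : {poly R}) (x : R) :
  (size p <= n.+1)%N -> x != 0 -> (inv_poly n p).[x] = x ^+ n * p.[x^-1].
Proof.
move=> sp x0; rewrite horner_poly (horner_coef_wide _ sp) mulr_sumr.
rewrite (reindex_inj rev_ord_inj) /=; apply: eq_bigr => i _.
have lin : (i <= n)%N by rewrite -ltnS.
by rewrite subSS subKn // mulrCA exprVn expfB_cond // (negPf x0).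
Qed.

(* Every complex zero is real, or the polynomial is zero. *)
Definition real_rooted (R : realType) (p : {poly R}) : Prop :=
  p = 0 \/
  forall z : R[i], root (map_poly (real_complex R) p) z -> Im z = 0.

(* The real zeros in weakly increasing order, repeated with multiplicity. *)
Definition zeros (R : realType) (p : {poly R}) : seq R :=
  flatten [seq nseq (mup x p) x | x <- rootsR p].

(* Between any two consecutive terms of t there is a term of s. Terms are
   counted with multiplicity: different gaps of t (possibly of length 0) use
   different positions of s, whence the injectivity of f. Thus [:: 0] does not
   separate [:: 0; 0; 0]. *)
Definition separates (R : realType) (s t : seq R) : Prop :=
  exists f : nat -> nat, injective f /\
    forall i : nat, (i.+1 < size t)%N ->
      (f i < size s)%N /\ t`_i <= s`_(f i) <= t`_i.+1.

Definition interlace (R : realType) (p q : {poly R}) : Prop :=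
  separates (zeros p) (zeros q) /\ separates (zeros q) (zeros p).

Definition prec (R : realType) (p q : {poly R}) : Prop :=
  [/\ real_rooted p, real_rooted q &
    [\/ p = 0, q = 0 |
      interlace p q /\
      forall x : R, (p^`()).[x] * q.[x] - p.[x] * (q^`()).[x] <= 0]].

(* deg p <= n and 0 <= p_0 <= p_n <= p_1 <= p_(n-1) <= ...; the list has n + 1
   entries, the last of which is p_((n+1)/2) with floor division. *)
Definition alternatingly_increasing (R : realType) (n : nat) (p : {poly R}) :=
  (size p <= n.+1)%N /\
  path <=%R 0
    [seq p`_(if odd j then n - j./2 else j./2)%N | j <- iota 0 n.+1].

(* Main.v *)
Require Import Defs.
From mathcomp Require Import all_boot all_order all_algebra.
From mathcomp Require Import boolp classical_sets reals topology normedtype trigo.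
From mathcomp Require Import polyrcf complex ring lra zify.
Set Implicit Arguments. Unset Strict Implicit. Unset Printing Implicit Defensive.
Import Order.TTheory GRing.Theory Num.Theory numFieldNormedType.Exports.
Local Open Scope ring_scope.

(** Expanding [r m + 1 = (m + 1) + (r - 1) m] writes every [A^n_{r,k}] as a
    nonnegative combination of the refined Eulerian polynomials [P_0, ..., P_n],
    where [P_j] is the numerator of the generating function of
    [m^j (m + 1)^(n - j)]. Reversal exchanges [P_j] and [P_(n - j)]. If [w] is the
    vector of weights of [p], the 2x2 minors of the rows [w_(n - j)] and [w_j] are
    nonnegative; this is where [r >= 2] enters. For [z] in the upper half plane
    the vectors [P_0(z), ..., P_n(z), z P_0(z), ..., z P_n(z)] turn
    counterclockwise within suitable half-turns, so
    [Im (p(z) * conj (I_n(p)(z))) >= 0] and neither factor vanishes. Following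
    the argument of [p / I_n(p)] along horizontal lines then gives real-rootedness
    and interlacing, and the expansion at real points gives the sign of the
    Wronskian. The coefficient inequalities hold for each [A^n_{r,k}] by induction
    on [n]. *)

(** * Numerators of generating functions *)

(** Coefficients below [N] of a product do not see the terms of index at least [N]. Truncating the
    series there replaces it by a polynomial, so polynomial ring identities and derivatives become
    available. *)
Lemma gf_numeratorP (R : realType) (a : nat -> R) d (h : {poly R}) :
  gf_numerator a d h <->
  forall N j, (j < N)%N -> ((1 - 'X) ^+ d * \poly_(i < N) a i)`_j = h`_j.
Proof.
have E N j : (j < N)%N ->
    ((1 - 'X) ^+ d * \poly_(i < N) a i)`_j =
    fps_mul (fun i => ((1 - 'X) ^+ d)`_i) a j.
  move=> jN; rewrite coefM; apply: eq_bigr => i _.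
  by rewrite coef_poly (leq_ltn_trans (leq_subr _ _) jN).
by split=> [gf N j jN|gf j]; [rewrite E | rewrite -(E j.+1) // gf].
Qed.

Lemma gf_numerator_inj (R : realType) (a : nat -> R) d (h g : {poly R}) :
  gf_numerator a d h -> gf_numerator a d g -> h = g.
Proof. by move=> hh hg; apply/polyP=> j; rewrite -hh hg. Qed.

Lemma eq_gf_numerator (R : realType) (a b : nat -> R) d (h : {poly R}) :
  a =1 b -> gf_numerator a d h -> gf_numerator b d h.
Proof. by move=> ab gf j; rewrite -gf; apply: eq_bigr => i _; rewrite ab. Qed.

Lemma gf_numerator_sum (R : realType) (I : Type) (s : seq I) (w : I -> R)
    (a : I -> nat -> R) d (h : I -> {poly R}) :
  (forall i, gf_numerator (a i) d (h i)) ->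
  gf_numerator (fun m => \sum_(i <- s) w i * a i m) d (\sum_(i <- s) w i *: h i).
Proof.
move=> gf j; rewrite coef_sum /fps_mul.
under eq_bigr do rewrite mulr_sumr.
rewrite exchange_big /=; apply: eq_bigr => i _.
by rewrite coefZ -gf mulr_sumr; apply: eq_bigr => l _; rewrite mulrCA.
Qed.

(** This is the numerator over [(1 - x)^(d+1)] obtained by applying [b x d/dx + c] to
    [h / (1 - x)^d]. *)
Definition step_poly (R : realType) (d : nat) (b c : R) (h : {poly R}) :=
  b *: ('X * (1 - 'X) * h^`() + d%:R *: ('X * h)) + c *: ((1 - 'X) * h).

Lemma coef_step_poly (R : realType) d (b c : R) h j :
  (step_poly d b c h)`_j =
  (b * j%:R + c) * h`_j + (b * (d.+1%:R - j%:R) - c) * ('X * h)`_j.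
Proof.
have -> : step_poly d b c h = b *: ('X * h^`() - 'X * ('X * h^`()) +
    d%:R *: ('X * h)) + c *: (h - 'X * h).
  by rewrite /step_poly -!mul_polyC; ring.
rewrite !(coefD, coefZ, coefN, coefXM, coef_deriv).
case: j => [|[|j]] /=.
- by ring.
- by ring.
by ring.
Qed.

Lemma gf_numerator_step (R : realType) (a : nat -> R) d (b c : R) h :
  gf_numerator a d h ->
  gf_numerator (fun m => (b * m%:R + c) * a m) d.+1 (step_poly d b c h).
Proof.
move=> /gf_numeratorP gf; apply/gf_numeratorP => N j jN.
set t := \poly_(i < N) a i.
have -> : \poly_(i < N) ((b * i%:R + c) * a i) = b *: ('X * t^`()) + c *: t.
  apply/polyP=> i; rewrite !(coefD, coefZ, coefXM, coef_deriv, coef_poly).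
  case: i => [|i] /=; first by case: ifP => _; ring.
  by case: ifP => _; ring.
(* The product rule gives [(1 - x)^(d+1) (b x t' + c t)] = [step_poly] of [(1 - x)^d t], exactly and
   without truncation error; [d = 0] is separated because of the factor [(1 - x)^(d-1)]. *)
transitivity (step_poly d b c ((1 - 'X) ^+ d * t))`_j.
  congr ((polyseq _)`_j); rewrite /step_poly derivM deriv_exp derivB derivX.
  rewrite (derivC 1) sub0r.
  case: d {gf} => [|d]; rewrite /= ?exprS -!mul_polyC.
    by ring.
  by ring.
rewrite !coef_step_poly !coefXM gf //; congr (_ + _ * _).
by case: j jN => //= j jN; rewrite gf // ltnW.
Qed.

(** * Refined Eulerian polynomials *)

(** For [k <= n] this is the descent polynomial of the permutations of [0, ..., n] with first letter
    [k]: the second letter, once relabelled, is some [i], and it creates a descent exactly when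
    [i < k]. *)
Fixpoint refined_eulerian (R : realType) (n k : nat) : {poly R} :=
  if n is m.+1 then
    'X * \sum_(0 <= i < k) refined_eulerian R m i +
    \sum_(k <= i < m.+1) refined_eulerian R m i
  else 1.

Lemma coef_1subX_inj (R : realType) N (u v : {poly R}) :
  (forall j, (j < N)%N -> ((1 - 'X) * u)`_j = ((1 - 'X) * v)`_j) ->
  forall j, (j < N)%N -> u`_j = v`_j.
Proof.
move=> uv; elim=> [|j IH] jN; have := uv _ jN;
  rewrite !mulrBl !mul1r !coefB !coefXM /= ?subr0 //.
by rewrite IH ?(ltnW jN) // => /addIr.
Qed.

(** Let [G l] be the numerator belonging to [m^l (m+1)^(n+1-l)]. Since [(m+1) - m = 1], the
    difference [G l - G (l+1)] is [1 - x] times the polynomial of index [l] at level [n]. Since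
    [m^(n+1)] is the shift of [(m+1)^(n+1)], also [G (n+1) = x G 0]. Telescoping determines every
    [G k]. *)
Lemma gf_refined_eulerian (R : realType) n k : (k <= n)%N ->
  gf_numerator (fun m => m%:R ^+ k * (m + 1)%:R ^+ (n - k)) n.+1
    (refined_eulerian R n k).
Proof.
elim: n k => [|n IH] k kn; apply/gf_numeratorP => N j jN.
  move: kn; rewrite leqn0 => /eqP->; rewrite expr1 mulrBl mul1r coefB coefXM.
  rewrite !coef_poly jN coefC /=; case: j jN => [|j] jN /=; first by ring.
  by rewrite (ltnW jN); ring.
pose a l m := m%:R ^+ l * (m + 1)%:R ^+ (n.+1 - l) : R.
pose G l : {poly R} := (1 - 'X) ^+ n.+2 * \poly_(i < N) a l i.
pose S l := \sum_(0 <= i < l) refined_eulerian R n i.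
rewrite -/(a k) -/(G k).
have G_diff l i : (l <= n)%N -> (i < N)%N ->
    (G l)`_i - (G l.+1)`_i = ((1 - 'X) * refined_eulerian R n l)`_i.
  move=> ln iN; have /gf_numeratorP gf := IH l ln.
  set b := (fun m => _) in gf.
  have -> : (G l)`_i - (G l.+1)`_i =
      ((1 - 'X) * ((1 - 'X) ^+ n.+1 * \poly_(i < N) b i))`_i.
    rewrite -coefB mulrA -exprS /G -mulrBr; congr ((polyseq (_ * _))`_i).
    apply/polyP=> m; rewrite coefB !coef_poly; case: ifP => _; last by ring.
    by rewrite /a /b subSn // subSS !exprS natrD; ring.
  rewrite !mulrBl !mul1r !coefB !coefXM gf //; congr (_ - _).
  by case: i iN => //= i iN; rewrite gf // ltnW.
have G_sum l i : (l <= n.+1)%N -> (i < N)%N ->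
    (G 0)`_i - (G l)`_i = ((1 - 'X) * S l)`_i.
  move=> + iN; elim: l => [|l IHl] ln.
    by rewrite /S big_geq // mulr0 coef0 subrr.
  rewrite /S big_nat_recr //= mulrDr coefD -/(S l) -G_diff // -IHl ?(ltnW ln) //.
  by ring.
have G_last i : (i < N)%N -> (G n.+1)`_i = ('X * G 0)`_i.
  rewrite /G mulrCA ![((1 - 'X) ^+ _ * _)`_i]coefM => iN.
  apply: eq_bigr => m _; congr (_ * _).
  rewrite coefXM !coef_poly /a; have mN : (i - m < N)%N by lia.
  rewrite mN; case: (i - m)%N mN => [|q] qN /=; first by rewrite expr0n mul0r.
  by rewrite (ltnW qN) subnn subn0 mulr1 mul1r addn1.
(* The full telescope gives [(1 - x) G 0 = (1 - x) S (n+1)] modulo [x^N], and [1 - x] can be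
   cancelled. *)
have G0 i : (i < N)%N -> (G 0)`_i = (S n.+1)`_i.
  move: i; apply: coef_1subX_inj => i iN.
  by rewrite -G_sum // G_last // mulrBl mul1r coefB.
have /= := G_sum _ _ kn jN; rewrite G0 // => /eqP; rewrite subr_eq => /eqP E.
have {}E : (G k)`_j = (S n.+1)`_j - ((1 - 'X) * S k)`_j by rewrite E; ring.
rewrite E /= -/(S k).
have -> : (S n.+1)`_j =
    (S k)`_j + (\sum_(k <= i < n.+1) refined_eulerian R n i)`_j.
  by rewrite -coefD /S -big_cat_nat.
by rewrite mulrBl mul1r !(coefD, coefN); ring.
Qed.

Lemma size_sum_leq (R : realType) m (I : Type) (s : seq I) (P : pred I)
    (F : I -> {poly R}) :
  (forall i, P i -> (size (F i) <= m)%N) ->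
  (size (\sum_(i <- s | P i) F i)%R <= m)%N.
Proof.
move=> sF; apply: (big_ind (fun p : {poly R} => (size p <= m)%N)) => //.
  by rewrite size_poly0.
by move=> u v su sv; apply: leq_trans (size_polyD _ _) _; rewrite geq_max su.
Qed.

Lemma size_refined_eulerian (R : realType) n k :
  (k <= n)%N -> (size (refined_eulerian R n k) <= n.+1)%N.
Proof.
elim: n k => [|n IH] k kn /=; first by rewrite size_poly1.
have S a b : (b <= n.+1)%N ->
    (size (\sum_(a <= i < b) refined_eulerian R n i)%R <= n.+1)%N.
  move=> bn; rewrite big_nat_cond; apply: size_sum_leq => i.
  by move=> /andP[/andP[_ ib] _]; apply: IH; lia.
apply: leq_trans (size_polyD _ _) _; rewrite geq_max; apply/andP; split.
  apply: leq_trans (size_polyMleq _ _) _.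
  by rewrite size_polyX /= ltnS S.
by apply: leq_trans (S _ _ _) _.
Qed.

Lemma refined_eulerian_ge0 (R : realType) n k j :
  0 <= (refined_eulerian R n k)`_j.
Proof.
elim: n k j => [|n IH] k j /=; first by rewrite coefC; case: ifP.
rewrite coefD coefXM !coef_sum addr_ge0 ?sumr_ge0 //.
by case: ifP => // _; rewrite sumr_ge0.
Qed.

(** * Reversal of coefficients *)

Lemma coef_inv_poly (R : realType) n (p : {poly R}) i :
  (inv_poly n p)`_i = if (i <= n)%N then p`_(n - i) else 0.
Proof. by rewrite coef_poly ltnS. Qed.

Lemma inv_poly_sum (R : realType) n (I : Type) (s : seq I) (P : pred I)
    (w : I -> R) (p : I -> {poly R}) :
  inv_poly n (\sum_(i <- s | P i) w i *: p i) =
  \sum_(i <- s | P i) w i *: inv_poly n (p i).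
Proof.
apply/polyP=> j; rewrite coef_sum coef_inv_poly.
under [RHS]eq_bigr do rewrite coefZ coef_inv_poly.
case: ifP => _; last by rewrite big1 // => i _; rewrite mulr0.
by rewrite coef_sum; apply: eq_bigr => i _; rewrite coefZ.
Qed.

Lemma inv_polyS (R : realType) n (p : {poly R}) : (size p <= n.+1)%N ->
  inv_poly n.+1 p = 'X * inv_poly n p.
Proof.
move=> sp; apply/polyP=> -[|j]; rewrite coef_inv_poly coefXM //=.
  by rewrite subn0 nth_default.
by rewrite coef_inv_poly ltnS subSS.
Qed.

Lemma inv_polyXM (R : realType) n (p : {poly R}) :
  inv_poly n.+1 ('X * p) = inv_poly n p.
Proof.
apply/polyP=> j; rewrite !coef_inv_poly coefXM.
case: (leqP j n) => [jn|nj]; first by rewrite leqW // subSn.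
by case: ifP => // jn; rewrite (_ : j = n.+1) ?subnn //; lia.
Qed.

Lemma inv_polyD (R : realType) n (p q : {poly R}) :
  inv_poly n (p + q) = inv_poly n p + inv_poly n q.
Proof.
apply/polyP=> j; rewrite coefD !coef_inv_poly coefD.
by case: ifP => // _; rewrite addr0.
Qed.

(** Reversal swaps the two sums of the recursion: the one carrying [x] loses it and the other gains
    it, while [i] becomes [n - i] inside each sum. *)
Lemma inv_refined_eulerian (R : realType) n k : (k <= n)%N ->
  inv_poly n (refined_eulerian R n k) = refined_eulerian R n (n - k).
Proof.
elim: n k => [|n IH] k kn /=.
  by apply/polyP=> -[|j]; rewrite coef_inv_poly //= coefC.
have S a b : (b <= n.+1)%N ->
    inv_poly n (\sum_(a <= i < b) refined_eulerian R n i) =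
    \sum_(n.+1 - b <= i < n.+1 - a) refined_eulerian R n i.
  move=> bn; under eq_bigr do rewrite -[refined_eulerian R n _]scale1r.
  rewrite inv_poly_sum.
  rewrite (@eq_big_nat _ _ _ _ _ _ (fun i => refined_eulerian R n (n - i)));
    last by move=> i /andP[_ ib]; rewrite scale1r IH //; lia.
  rewrite -{1}[a]add0n -{1}[(n.+1 - b)%N]add0n !big_addn.
  rewrite (_ : (n.+1 - a - (n.+1 - b) = b - a)%N); last by lia.
  rewrite big_nat_rev /=; apply: eq_big_nat => i /andP[_ ib].
  by congr refined_eulerian; lia.
rewrite inv_polyD inv_polyXM inv_polyS; last first.
  rewrite big_nat_cond; apply: size_sum_leq => i /andP[/andP[_ ib] _].
  by apply: size_refined_eulerian; lia.
by rewrite !S // subn0 subnn addrC.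
Qed.

(** * Values in the upper half plane *)

(* [cross u v] is [Im (u * conj v)]. *)
Definition cross (R : realType) (u v : R[i]) : R :=
  complex.Im u * complex.Re v - complex.Re u * complex.Im v.

Definition ceval (R : realType) (z : R[i]) (p : {poly R}) : R[i] :=
  (map_poly (real_complex R) p).[z].

Lemma cross0l (R : realType) (v : R[i]) : cross 0 v = 0.
Proof. by rewrite /cross !mul0r subrr. Qed.

Lemma crossC (R : realType) (u v : R[i]) : cross u v = - cross v u.
Proof. by rewrite /cross; ring. Qed.

Lemma crossDl (R : realType) (u v w : R[i]) :
  cross (u + v) w = cross u w + cross v w.
Proof. by case: u v w => [a b] [c d] [e f]; rewrite /cross /=; ring. Qed.

Lemma cross_suml (R : realType) (I : Type) (s : seq I) (P : pred I)
    (u : I -> R[i]) v :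
  cross (\sum_(i <- s | P i) u i) v = \sum_(i <- s | P i) cross (u i) v.
Proof.
by apply: (big_morph (fun u => cross u v)) => [x y|]; rewrite ?crossDl ?cross0l.
Qed.

Lemma cross_sumr (R : realType) (I : Type) (s : seq I) (P : pred I)
    (u : I -> R[i]) v :
  cross v (\sum_(i <- s | P i) u i) = \sum_(i <- s | P i) cross v (u i).
Proof.
by rewrite crossC cross_suml -sumrN; apply: eq_bigr => i _; rewrite -crossC.
Qed.

Lemma crossZl (R : realType) (a : R) (u v : R[i]) :
  cross (a%:C%C * u) v = a * cross u v.
Proof. by case: u v => [b c] [d e]; rewrite /cross /=; ring. Qed.

Lemma crossZr (R : realType) (a : R) (u v : R[i]) :
  cross u (a%:C%C * v) = a * cross u v.
Proof. by rewrite crossC crossZl -mulrN -crossC. Qed.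

(** A factor [z] in the upper half plane turns a nonzero vector strictly counterclockwise; this is
    where the strict inequalities below come from. *)
Lemma cross_mull (R : realType) (z u : R[i]) :
  cross (z * u) u = complex.Im z * (complex.Re u ^+ 2 + complex.Im u ^+ 2).
Proof. by case: z u => [x y] [b c]; rewrite /cross /=; ring. Qed.

Lemma sqr_norm_gt0 (R : realType) (u : R[i]) :
  u != 0 -> 0 < complex.Re u ^+ 2 + complex.Im u ^+ 2.
Proof.
case: u => a b; rewrite eq_complex /= => ab0.
rewrite lt_neqAle addr_ge0 ?sqr_ge0 // andbT eq_sym paddr_eq0 ?sqr_ge0 //.
by rewrite !sqrf_eq0.
Qed.

Lemma sqr_norm_ge0 (R : realType) (u : R[i]) :
  0 <= complex.Re u ^+ 2 + complex.Im u ^+ 2.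
Proof. by rewrite addr_ge0 ?sqr_ge0. Qed.

(* For [i <= j], the turns from [u i] to [u j] and from [u j] to [z * u i] are
   counterclockwise and at most a half-turn. *)
Definition fan (R : realType) (z : R[i]) (n : nat) (u : nat -> R[i]) :=
  (forall i, (i <= n)%N -> u i != 0) /\
  forall i j, (i <= j)%N -> (j <= n)%N ->
    0 <= cross (u j) (u i) /\ 0 <= cross (z * u i) (u j).

(** Crossing the sum with a pivot makes all terms nonnegative and one of them positive. The pivot is
    the last vector multiplied by [z], or [z * u 0] on the other side if there is none. *)
Lemma fan_sum_neq0 (R : realType) (z : R[i]) n (u : nat -> R[i]) k :
  0 < complex.Im z -> fan z n u -> (k <= n.+1)%N ->
  z * (\sum_(0 <= i < k) u i) + \sum_(k <= i < n.+1) u i != 0.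
Proof.
move=> z0 [u0 fu] kn; apply/eqP => S0.
have pos j : (j <= n)%N -> 0 < cross (z * u j) (u j).
  by move=> jn; rewrite cross_mull mulr_gt0 // sqr_norm_gt0 ?u0.
case: k kn S0 => [|k] kn S0.
  have := cross_sumr (index_iota 0 n.+1) xpredT u (z * u 0%N).
  move: S0; rewrite big_geq // mulr0 add0r => ->; rewrite crossC cross0l oppr0.
  rewrite big_nat_recl //= => /esym/eqP; rewrite gt_eqF // ltr_pwDl ?pos //.
  rewrite big_nat_cond sumr_ge0 // => i /andP[/andP[_ i_n] _].
  by case: (fu 0%N i.+1).
have := cross0l (u k); rewrite -S0 crossDl mulr_sumr !cross_suml.
rewrite big_nat_recr //= => /eqP; rewrite gt_eqF //.
rewrite ltr_pwDl //; last first.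
  rewrite big_nat_cond sumr_ge0 // => i /andP[/andP[ki i_n] _].
  by case: (fu k i) => //; lia.
rewrite ltr_wpDl ?pos // big_nat_cond sumr_ge0 // => i /andP[/andP[_ ik] _].
by case: (fu i k) => //; lia.
Qed.

Lemma cross_sum_ge0 (R : realType) (u v : nat -> R[i]) a b c d :
  (forall i j, (a <= i < b)%N -> (c <= j < d)%N -> 0 <= cross (u i) (v j)) ->
  0 <= cross (\sum_(a <= i < b) u i) (\sum_(c <= j < d) v j).
Proof.
move=> uv; rewrite cross_suml big_nat_cond sumr_ge0 // => i /andP[iab _].
rewrite cross_sumr big_nat_cond sumr_ge0 // => j /andP[jcd _]; exact: uv.
Qed.

Lemma fan_step (R : realType) (z : R[i]) n (u : nat -> R[i]) :
  0 < complex.Im z -> fan z n u ->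
  fan z n.+1 (fun k =>
    z * (\sum_(0 <= i < k) u i) + \sum_(k <= i < n.+1) u i).
Proof.
move=> z0 fanu; split=> [k kn|i j ij jn]; first exact: fan_sum_neq0.
have [_ fu] := fanu.
(* The two new vectors are [z * a + b + c] and [z * (a + b) + c], so only the three blocks cut out
   by [i] and [j] matter. *)
set a := \sum_(0 <= l < i) u l; set b := \sum_(i <= l < j) u l.
set c := \sum_(j <= l < n.+1) u l.
have -> : \sum_(0 <= l < j) u l = a + b by rewrite /a /b -big_cat_nat.
have -> : \sum_(i <= l < n.+1) u l = b + c by rewrite /b /c -big_cat_nat.
have ba : 0 <= cross b a.
  by apply: cross_sum_ge0 => l m lb ma; case: (fu m l) => //; lia.
have cb : 0 <= cross c b.
  by apply: cross_sum_ge0 => l m lb ma; case: (fu m l) => //; lia.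
have zab : 0 <= cross (z * a) b.
  rewrite /a mulr_sumr; apply: cross_sum_ge0 => l m lb ma.
  by case: (fu l m) => //; lia.
have zbc : 0 <= cross (z * b) c.
  rewrite /b mulr_sumr; apply: cross_sum_ge0 => l m lb ma.
  by case: (fu l m) => //; lia.
have z2 := sqr_norm_ge0 z.
have N2 v : 0 <= complex.Im z * (complex.Re v ^+ 2 + complex.Im v ^+ 2).
  by rewrite mulr_ge0 ?sqr_norm_ge0 // ltW.
split.
(* In the bilinear expansion the two pairings of [z * a] with [c] cancel, and every remaining term
   is nonnegative. *)
- rewrite (_ : cross _ _ = cross (z * a) b +
    (complex.Re z ^+ 2 + complex.Im z ^+ 2) * cross b a +
    complex.Im z * (complex.Re b ^+ 2 + complex.Im b ^+ 2) +
    cross (z * b) c + cross c b).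
    by do ?[assumption | exact: mulr_ge0 | apply: addr_ge0].
  case: (z) (a) (b) (c) => [x y] [a1 a2] [b1 b2] [c1 c2].
  by rewrite /cross /=; ring.
rewrite (_ : cross _ _ = (complex.Re z ^+ 2 + complex.Im z ^+ 2) * cross (z * a) b +
  complex.Im z * (complex.Re (z * a + c) ^+ 2 + complex.Im (z * a + c) ^+ 2) +
  (complex.Re z ^+ 2 + complex.Im z ^+ 2) * cross b a + cross (z * b) c +
  (complex.Re z ^+ 2 + complex.Im z ^+ 2) * cross c b).
  by do ?[assumption | exact: mulr_ge0 | apply: addr_ge0].
case: (z) (a) (b) (c) => [x y] [a1 a2] [b1 b2] [c1 c2].
by rewrite /cross /=; ring.
Qed.

Lemma cevalD (R : realType) z (p q : {poly R}) :
  ceval z (p + q) = ceval z p + ceval z q.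
Proof. by rewrite /ceval rmorphD hornerD. Qed.

Lemma cevalXM (R : realType) z (p : {poly R}) : ceval z ('X * p) = z * ceval z p.
Proof. by rewrite /ceval rmorphM /= map_polyX hornerM hornerX. Qed.

Lemma cevalZ (R : realType) z a (p : {poly R}) :
  ceval z (a *: p) = a%:C%C * ceval z p.
Proof. by rewrite /ceval map_polyZ hornerZ. Qed.

Lemma ceval_sum (R : realType) z (I : Type) (s : seq I) (P : pred I)
    (p : I -> {poly R}) :
  ceval z (\sum_(i <- s | P i) p i) = \sum_(i <- s | P i) ceval z (p i).
Proof. by rewrite /ceval rmorph_sum horner_sum. Qed.

Lemma fan_refined_eulerian (R : realType) (z : R[i]) n : 0 < complex.Im z ->
  fan z n (fun k => ceval z (refined_eulerian R n k)).
Proof.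
move=> z0; elim: n => [|n IH] /=.
  have -> : ceval z (1 : {poly R}) = 1 by rewrite /ceval rmorph1 hornerC.
  split=> [i _|i j _ _]; first exact: oner_neq0.
  by rewrite /cross mulr1 /= ; split; lra.
have [f0 f] := fan_step z0 IH.
split=> [i /f0|i j /f {}f /f]; rewrite !cevalD !cevalXM !ceval_sum //.
Qed.

(** Let [k] be the least index of nonzero weight. Crossing [z * u k] with the sum gives a positive
    term at [k], nonnegative terms after it and zero before it. *)
Lemma cone_neq0 (R : realType) (z : R[i]) n (u : nat -> R[i]) (w : nat -> R) :
  0 < complex.Im z -> fan z n u -> (forall i, (i <= n)%N -> 0 <= w i) ->
  (exists2 i, (i <= n)%N & w i != 0) ->
  \sum_(0 <= i < n.+1) (w i)%:C%C * u i != 0.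
Proof.
move=> z0 [u0 fu] w_ge0 [i0 i0n wi0].
have ex : exists i, (i <= n)%N && (w i != 0) by exists i0; rewrite i0n.
case: (ex_minnP ex) => k /andP[kn wk] kmin.
apply/eqP => S0; have := cross0l (z * u k).
rewrite -S0 crossC cross_sumr => /eqP; rewrite oppr_eq0 gt_eqF //.
rewrite big_mkord (bigD1 (Ordinal (kn : (k < n.+1)%N))) //= ltr_pwDl //.
  by rewrite crossZr cross_mull !mulr_gt0 ?sqr_norm_gt0 ?u0 //
       lt_neqAle eq_sym wk w_ge0.
apply: sumr_ge0 => i _; rewrite crossZr.
have i_n : (i <= n)%N by rewrite -ltnS.
have [ki|ik] := leqP k i; first by rewrite mulr_ge0 ?w_ge0 //; case: (fu k i).
have [->|wi] := eqVneq (w i) 0; first by rewrite mul0r.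
by have := kmin i; rewrite i_n wi => /(_ isT); lia.
Qed.

(* Only the 2x2 minors of the two rows of weights matter. *)
Lemma cross_cone_ge0 (R : realType) (z : R[i]) n (u : nat -> R[i])
    (w v : nat -> R) :
  fan z n u ->
  (forall i j, (i < j)%N -> (j <= n)%N -> v j * w i <= v i * w j) ->
  0 <= cross (\sum_(0 <= i < n.+1) (w i)%:C%C * u i)
             (\sum_(0 <= i < n.+1) (v i)%:C%C * u i).
Proof.
move=> [_ fu] wv; rewrite cross_suml.
under eq_bigr => i _ do
  (rewrite cross_sumr; under eq_bigr => j _ do rewrite crossZl crossZr).
(* Adding to the double sum its transpose pairs [(i, j)] with [(j, i)]; by antisymmetry each pair is
   a minor of the weights times one cross product. *)
set S := (X in 0 <= X).
suff : 0 <= S + S by rewrite -mulr2n pmulrn_lge0.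
rewrite {2}/S exchange_big /= -big_split /= big_nat_cond sumr_ge0 // => i.
move=> /andP[/andP[_ i_n] _]; rewrite -big_split /= big_nat_cond sumr_ge0 // => j.
move=> /andP[/andP[_ j_n] _]; rewrite [cross (u j) (u i)]crossC.
rewrite (_ : _ + _ = (w i * v j - w j * v i) * cross (u i) (u j)); last by ring.
have [ij|ji|ij] := ltngtP i j.
- rewrite -mulrNN -crossC mulr_ge0 //; last by case: (fu i j) => //; lia.
  by rewrite opprB subr_ge0 mulrC [w j * _]mulrC wv.
- rewrite mulr_ge0 //; last by case: (fu j i) => //; lia.
  by rewrite subr_ge0 mulrC [w i * _]mulrC wv.
by rewrite ij subrr mul0r.
Qed.

(** * Factorization and interlacing of zeros *)

Definition upper_nonvanishing (R : realType) (p : {poly R}) :=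
  forall z : R[i], 0 < complex.Im z -> ceval z p != 0.

Lemma upper_nonvanishing_neq0 (R : realType) (p : {poly R}) :
  upper_nonvanishing p -> p != 0.
Proof.
move=> /(_ (Complex 0 1)) /= /(_ ltr01); apply: contraNneq => ->.
by rewrite /ceval rmorph0 horner0.
Qed.

(** Real coefficients make the zeros symmetric under conjugation, so the lower half plane is
    excluded as well. *)
Lemma upper_nonvanishing_root (R : realType) (p : {poly R}) (z : R[i]) :
  upper_nonvanishing p -> root (map_poly (real_complex R) p) z ->
  complex.Im z = 0.
Proof.
move=> up pz; case: (ltgtP (complex.Im z) 0) => // z0.
  have : root (map_poly (real_complex R) p) (z^*)%C.
    rewrite -complex_root_conj -map_poly_comp /=.
    rewrite (eq_map_poly (g := real_complex R)) //.
    by move=> x /=; rewrite oppr0.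
  rewrite /root -/(ceval _ _) (negPf (up _ _)) //.
  by case: (z) z0 => a b /=; rewrite oppr_gt0.
by move: pz; rewrite /root -/(ceval _ _) (negPf (up _ _)).
Qed.

Lemma upper_nonvanishing_real_rooted (R : realType) (p : {poly R}) :
  upper_nonvanishing p -> real_rooted p.
Proof.
move=> up; right=> z /(upper_nonvanishing_root up) z0.
by rewrite -complexIm z0.
Qed.

(** Each complex zero is real and can be divided out; the quotient still has no zero in the upper
    half plane, and the degree drops. *)
Lemma upper_nonvanishing_split (R : realType) (p : {poly R}) :
  upper_nonvanishing p ->
  exists s, p = lead_coef p *: \prod_(a <- s) ('X - a%:P).
Proof.
move: {2}(size p) (leqnn (size p)) => m; elim: m p => [|m IH] p sp up.
  by exists [::]; rewrite big_nil; apply/eqP;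
    have := upper_nonvanishing_neq0 up; rewrite -size_poly_gt0; lia.
have [sp1|sp1] := leqP (size p) 1.
  exists [::]; rewrite big_nil alg_polyC {1}[p]size1_polyC //.
  by rewrite /lead_coef; case: (size p) sp1 => [|[]].
have : size (map_poly (real_complex R) p) != 1%N.
  by rewrite size_map_poly neq_ltn sp1 orbT.
move=> /closed_rootP[z pz]; have zr := upper_nonvanishing_root up pz.
have : root p (complex.Re z).
  rewrite -(fmorph_root (real_complex R)) /=.
  by case: z zr pz => a b /= ->.
move=> /factor_theorem[q pE]; set a := complex.Re z in pE.
have q0 : q != 0.
  by apply: contraTneq sp1 => q0; rewrite pE q0 mul0r size_poly0.
have lc : lead_coef p = lead_coef q.
  by rewrite pE lead_coef_Mmonic // monicXsubC.
have [|w w0|s qE] := IH q.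
- by move: sp; rewrite pE size_Mmonic ?monicXsubC // size_XsubC addn2 /= ltnS.
- apply: contraNneq (up w w0) => qw.
  by rewrite pE /ceval rmorphM hornerM -/(ceval _ _) qw mul0r.
by exists (a :: s); rewrite big_cons lc mulrC scalerAl -qE -pE.
Qed.

Lemma mup_prod_XsubC (R : realType) (s : seq R) x :
  mup x (\prod_(a <- s) ('X - a%:P)) = count_mem x s.
Proof.
elim: s => [|a s IH]; first by rewrite big_nil mupNroot // root1.
rewrite big_cons mupM ?polyXsubC_eq0 ?monic_neq0 ?monic_prod_XsubC ?monicXsubC //.
by rewrite IH -[X in mup x X]expr1 mup_XsubCX /=; case: eqVneq.
Qed.

Lemma zeros_split (R : realType) (p : {poly R}) c s :
  c != 0 -> p = c *: \prod_(a <- s) ('X - a%:P) -> perm_eq (zeros p) s.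
Proof.
move=> c0 pE; have p0 : p != 0.
  by rewrite pE scaler_eq0 negb_or c0 monic_neq0 // monic_prod_XsubC.
have mupE x : mup x p = count_mem x s.
  rewrite pE -mul_polyC mupMr ?mup_prod_XsubC //.
  by rewrite rootC.
apply/allP => x _ /=; apply/eqP; rewrite -mupE /zeros count_flatten -map_comp.
rewrite (eq_map (g := fun y => (y == x) * mup x p)%N); last first.
  move=> y /=; rewrite count_nseq /=; case: eqVneq => [->|//].
  by rewrite mul1n.
have -> (r : seq R) : sumn [seq ((y == x) * mup x p)%N | y <- r] =
    (count_mem x r * mup x p)%N.
  by elim: r => //= y r ->; rewrite mulnDl.
have u : uniq (rootsR p) by apply/lt_sorted_uniq/sorted_roots.
rewrite count_uniq_mem //; have [xr|] := boolP (x \in rootsR p).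
  by rewrite mul1n.
by rewrite mul0n -(roots_on_rootsR p0) /= => /mupNroot ->.
Qed.

Lemma sorted_flatten_nseq (R : realType) (m : R -> nat) (s : seq R) :
  sorted <%R s -> sorted <=%R (flatten [seq nseq (m x) x | x <- s]).
Proof.
elim: s => //= x s IH; rewrite lt_path_sortedE => /andP[/allP xs ss].
elim: (m x) => [|k IHk] /=; first exact: IH.
rewrite le_path_sortedE IHk andbT all_cat all_nseq lexx orbT /=.
apply/allP => y /flattenP[_ /mapP[w ws ->]]; rewrite mem_nseq.
by move=> /andP[_ /eqP->]; apply/ltW/xs.
Qed.

Lemma sorted_zeros (R : realType) (p : {poly R}) : sorted <=%R (zeros p).
Proof. exact/sorted_flatten_nseq/sorted_roots. Qed.

(** Count comparisons will hold only off a finite set of exceptional points [u]; this supplies test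
    points that avoid it. *)
Lemma between_notin (R : realType) (u : seq R) (a b : R) :
  a < b -> exists2 x, a < x < b & x \notin u.
Proof.
elim: u b => [|y u IH] b ab; first by exists ((a + b) / 2); [lra|].
have [ayb|nayb] := boolP (a < y < b).
  have [x /andP[ax xy] xu] := IH y (proj1 (andP ayb)).
  exists x; last by rewrite inE lt_eqF // xu.
  by rewrite ax (lt_trans xy) //; case/andP: ayb.
have [x axb xu] := IH b ab; exists x => //.
by rewrite inE negb_or xu andbT; apply: contraNneq nayb => <-.
Qed.

(** In a sorted list the entry of index [i] lies below [x] exactly when more than [i] entries do.
    The count bounds therefore amount to [s_0 <= t_0 <= s_1 <= t_1 <= ...], any failure being
    detected at a test point inside the offending gap. *)
Lemma separates_count (R : realType) (u s t : seq R) :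
  sorted <=%R s -> sorted <=%R t ->
  (forall x, x \notin u ->
     (count (< x) t <= count (< x) s)%N &&
     (count (< x) s <= (count (< x) t).+1)%N) ->
  separates s t /\ separates t s.
Proof.
move=> ss st st_count.
have nth_lt (r : seq R) i (x : R) : sorted <=%R r -> (i < size r)%N ->
      (i < count (< x) r)%N = (r`_i < x).
  move=> sr ir; apply/idP/idP; first exact: nth_count_lt.
  move=> rx; rewrite ltnNge; apply/negP => ci.
  by have := @nth_count_ge _ R x 0 r i sr; rewrite ci ir leNgt rx => /(_ isT).
(* To the right of all entries the counts are the lengths. *)
have size_le : (size t <= size s)%N /\ (size s <= (size t).+1)%N.
  pose m := 1 + \sum_(y <- s ++ t) `|y|.
  have lt_m y x : y \in s ++ t -> m < x -> y < x.
    move=> yst; apply: lt_trans; rewrite /m (big_rem y) //=.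
    rewrite (le_lt_trans (ler_norm y)) //.
    have : 0 <= \sum_(y <- rem y (s ++ t)) `|y| by rewrite sumr_ge0.
    lra.
  have [x /andP[mx _] xu] := @between_notin R u m (m + 1) ltac:(lra).
  have c_s : count (< x) s = size s.
    apply/eqP; rewrite -all_count; apply/allP => y ys.
    by rewrite /= (lt_m _ _ _ mx) // mem_cat ys.
  have c_t : count (< x) t = size t.
    apply/eqP; rewrite -all_count; apply/allP => y yt.
    by rewrite /= (lt_m _ _ _ mx) // mem_cat yt orbT.
  by have := st_count x xu; rewrite c_s c_t => /andP[].
have le_st i : (i < size t)%N -> s`_i <= t`_i.
  move=> it; rewrite leNgt; apply/negP => /(between_notin u)[x /andP[tx xs] xu].
  have := st_count x xu; have := nth_lt t i x st it; rewrite tx.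
  have := nth_lt s i x ss; rewrite (leq_trans it) ?(proj1 size_le) // => /(_ isT).
  by rewrite ltNge (ltW xs) /=; lia.
have le_ts i : (i.+1 < size s)%N -> t`_i <= s`_i.+1.
  move=> is_; rewrite leNgt; apply/negP => /(between_notin u)[x /andP[sx xt] xu].
  have := st_count x xu; have := nth_lt s i.+1 x ss is_; rewrite sx.
  have := nth_lt t i x st; rewrite -ltnS (leq_trans is_) ?(proj2 size_le) //.
  by move=> /(_ isT); rewrite ltNge (ltW xt) /=; lia.
split.
  (* Between [t_i] and [t_(i+1)] lies [s_(i+1)]; in the other direction [t_i] lies between [s_i] and
     [s_(i+1)], whence the witness [id]. *)
  exists succn; split=> [|i it]; first exact: succn_inj.
  have is_ := leq_trans it (proj1 size_le).
  by rewrite is_ le_ts ?le_st.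
exists id; split=> [|i is_]; first exact: inj_id.
have it : (i < size t)%N by rewrite -ltnS (leq_trans is_) ?(proj2 size_le).
by rewrite it le_st ?le_ts.
Qed.

(** * Behaviour near the real line and the Wronskian *)

(** The imaginary part at [x + e i] is an explicit multiple of [e], which can be divided out before
    letting [e] tend to 0. *)
Lemma ceval_near_real (R : realType) (p : {poly R}) (x : R) :
  exists A B : {poly R},
    [/\ forall e, ceval (Complex x e) p = Complex A.[e] (e * B.[e]),
        A.[0] = p.[x] & B.[0] = p^`().[x]].
Proof.
elim/poly_ind: p => [|p c [A [B [pE A0 B0]]]].
  by exists 0, 0; split=> [e||]; rewrite ?deriv0 /ceval ?rmorph0 !horner0 ?mulr0.
exists (x *: A - 'X^2 * B + c%:P), (A + x *: B); split.
- move=> e; rewrite mulrC cevalD cevalXM pE /ceval map_polyC hornerC.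
  by rewrite !hornerE /=; apply/eqP; rewrite eq_complex /=; apply/andP; split;
    apply/eqP; ring.
- by rewrite !hornerE A0 /=; ring.
by rewrite !derivE !hornerE /= A0 B0; ring.
Qed.

Lemma horner0_ge0 (R : realType) (p : {poly R}) :
  (forall e, 0 < e -> 0 <= p.[e]) -> 0 <= p.[0].
Proof.
move=> p_ge0; rewrite leNgt; apply/negP => p0.
have [d d0 /(_ (d / 2))] := @poly_cont R 0 p (- p.[0]) ltac:(lra).
rewrite subr0 gtr0_norm; last by lra.
have d2 : d / 2 < d by lra.
move=> /(_ d2); have := p_ge0 (d / 2) ltac:(lra).
by rewrite ltr_norml => h /andP[_]; lra.
Qed.

(** At [x + e i] the cross product is [e] times a real polynomial in [e], whose value at 0 is
    [f q' - f' q] at [x]. Positivity for [e > 0] passes to [e = 0] by continuity. *)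
Lemma cross_wronskian (R : realType) (f q : {poly R}) x :
  (forall z : R[i], 0 < complex.Im z -> 0 <= cross (ceval z q) (ceval z f)) ->
  (f^`()).[x] * q.[x] - f.[x] * (q^`()).[x] <= 0.
Proof.
move=> qf; have [A [B [fE <- <-]]] := ceval_near_real f x.
have [A' [B' [qE <- <-]]] := ceval_near_real q x.
have := @horner0_ge0 R (B' * A - A' * B); rewrite !hornerE => C0.
suff /C0 : forall e, 0 < e -> 0 <= (B' * A - A' * B).[e] by lra.
move=> e e0; have := qf (Complex x e) e0; rewrite qE fE /cross !hornerE /=.
rewrite (_ : _ - _ = e * (B'.[e] * A.[e] - A'.[e] * B.[e])); last by ring.
by rewrite pmulr_rge0.
Qed.

(** * Arguments along horizontal lines *)

(* The argument in ]0, pi[ of [x - a + e * 'i], for e > 0. *)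
Definition angle (R : realType) (e a x : R) : R := pi / 2 - atan ((x - a) / e).

Lemma angle_polar (R : realType) (e a x : R) : 0 < e ->
  exists2 r, 0 < r & x - a = r * cos (angle e a x) /\ e = r * sin (angle e a x).
Proof.
move=> e0; set t := atan ((x - a) / e).
have ct : 0 < cos t by rewrite cos_gt0_pihalf // atan_gtNpi2 atan_ltpi2.
have tanE : sin t / cos t = (x - a) / e by rewrite -/(tan t) atanK.
have cosA : cos (angle e a x) = sin t.
  by rewrite /angle -/t cosB cos_pihalf sin_pihalf mul0r add0r mul1r.
have sinA : sin (angle e a x) = cos t.
  by rewrite /angle -/t sinB cos_pihalf sin_pihalf mul0r subr0 mul1r.
exists (e / cos t); first exact: divr_gt0.
rewrite cosA sinA; split; last by rewrite divfK ?gt_eqF.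
by rewrite mulrAC -mulrA tanE mulrC divfK ?gt_eqF.
Qed.

(** This is an argument at [x + e i] of the monic polynomial with zeros [s]. It is not reduced
    modulo [2 pi], so it is continuous in [x] and its limit as [e] tends to 0 counts zeros. *)
Definition angle_sum (R : realType) (e : R) (s : seq R) (x : R) : R :=
  \sum_(a <- s) angle e a x.

Lemma ceval_polar (R : realType) (e x : R) (c : R) (s : seq R) :
  0 < e -> 0 < c -> exists2 r, 0 < r &
    ceval (Complex x e) (c *: \prod_(a <- s) ('X - a%:P)) =
    Complex (r * cos (angle_sum e s x)) (r * sin (angle_sum e s x)).
Proof.
move=> e0 c0; rewrite /angle_sum; elim: s => [|a s [r r0 IH]].
  exists c => //; rewrite !big_nil cos0 sin0 mulr1 mulr0.
  by rewrite alg_polyC /ceval map_polyC hornerC.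
have [r' r'0 [xE eE]] := angle_polar a x e0.
exists (r' * r); first exact: mulr_gt0.
rewrite !big_cons scalerAr /ceval rmorphM hornerM -!/(ceval _ _) IH.
have -> : ceval (Complex x e) ('X - a%:P) =
    Complex (r' * cos (angle e a x)) (r' * sin (angle e a x)).
  rewrite /ceval rmorphB /= map_polyX map_polyC hornerXsubC -xE -eE.
  by apply/eqP; rewrite eq_complex /= subr0 !eqxx.
by rewrite cosD sinD; apply/eqP; rewrite eq_complex /=; apply/andP;
  split; apply/eqP; ring.
Qed.

Lemma continuous_angle_sum (R : realType) (e : R) (s : seq R) :
  continuous (angle_sum e s).
Proof.
rewrite /angle_sum; elim: s => [|a s IH] x.
  by under eq_fun do rewrite big_nil; apply: cvg_cst.
under eq_fun do rewrite big_cons.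
apply: cvgD; last exact: IH.
apply: cvgB; first exact: cvg_cst.
apply: (@continuous_comp _ _ _ (fun x => (x - a) / e) (@atan R));
  last exact: continuous_atan.
apply: cvgM; last exact: cvg_cst.
by apply: cvgB; [exact: cvg_id | exact: cvg_cst].
Qed.

Lemma atan_large (R : realType) (d : R) : 0 < d ->
  exists2 m, 0 < m & forall t, m < t -> `|pi / 2 - atan t| < d.
Proof.
move=> d0; have /cvgrPdist_lt/(_ d d0)[m [mr mP]] := @cvgy_atan R.
exists (Num.max m 1); first by rewrite lt_max ltr01 orbT.
by move=> t; rewrite gt_max => /andP[mt _]; exact: mP.
Qed.

Lemma angle_limit (R : realType) (a x d : R) : x != a -> 0 < d ->
  exists2 e0, 0 < e0 & forall e, 0 < e < e0 ->
    `|angle e a x - pi * (x < a)%R%:R| < d.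
Proof.
move=> xa d0; have [m m0 mP] := atan_large d0.
exists (`|x - a| / m); first by rewrite divr_gt0 // normr_gt0 subr_eq0.
move=> e /andP[e0]; rewrite ltr_pdivlMr // mulrC -ltr_pdivlMr // => me.
rewrite /angle; case: (ltgtP x a) xa => // xa _; rewrite /= ?mulr1 ?mulr0 ?subr0.
  rewrite distrC (_ : _ - _ = pi / 2 - atan (- ((x - a) / e))).
    by apply: mP; move: me; rewrite ltr0_norm ?subr_lt0 // mulNr.
  by rewrite atanN; lra.
by apply: mP; move: me; rewrite gtr0_norm ?subr_gt0.
Qed.

Lemma angle_sum_limit (R : realType) (s : seq R) (x d : R) : x \notin s -> 0 < d ->
  exists2 e0, 0 < e0 & forall e, 0 < e < e0 ->
    `|angle_sum e s x - pi * (count (> x)%R s)%:R| < d.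
Proof.
rewrite /angle_sum; elim: s d => [|a s IH] d /=.
  move=> _ d0; exists 1 => // e _.
  by rewrite big_nil mulr0 subrr normr0.
rewrite inE negb_or => /andP[xa xs] d0.
have [|e1 e10 h1] := @angle_limit R a x (d / 2) xa; first by lra.
have [||e2 e20 h2] := IH (d / 2) => //; first by lra.
exists (Num.min e1 e2); first by rewrite lt_min e10.
move=> e; rewrite lt_min => /andP[e0 /andP[ee1 ee2]].
rewrite big_cons natrD mulrDr opprD addrACA.
have := h1 e; have := h2 e; rewrite e0 ee1 ee2 => /(_ isT) + /(_ isT).
by move=> ? ?; apply: le_lt_trans (ler_normD _ _) _; lra.
Qed.

(** A nonnegative sine confines [D] to the strips [[2 l pi, (2 l + 1) pi]]. The value at [b] selects
    the strip with [l = 0], and a continuous function cannot jump to another. *)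
Lemma sin_ge0_strip (R : realType) (D : R -> R) (a b : R) :
  a <= b -> continuous D -> (forall x, 0 <= sin (D x)) ->
  `|D b| < pi / 2 -> 0 <= D a <= pi.
Proof.
move=> ab cD sD; rewrite ltr_norml => /andP[Db1 Db2].
have pi0 := @pi_gt0 R.
have sin_neg (v : R) : - (pi / 2) <= v < 0 -> sin v < 0.
  move=> /andP[v1 v2]; rewrite -oppr_gt0 -sinN sin_gt0_pi //; lra.
have Db0 : 0 <= D b.
  rewrite leNgt; apply/negP => Db; have := sin_neg (D b).
  by rewrite (ltW Db1) Db => /(_ isT); rewrite ltNge sD.
have cD' : ({within `[a, b], continuous D})%classic by exact: continuous_subspaceT.
(* If [D a] were outside the strip, [D] would take a value in [[- pi / 2, 0[] or in []pi, 3 pi /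
   2]], where the sine is negative; the [Num.max] and [Num.min] below clip [D a] to these ranges. *)
apply/andP; split; rewrite leNgt; apply/negP => Da.
  have [|c _ Dc] := @IVT R D a b (Num.max (D a) (- (pi / 2))) ab cD'.
    have Dab : D a <= D b by lra.
    by rewrite (min_l Dab) (max_r Dab) le_max lexx ge_max Dab (ltW Db1).
  have := sD c; rewrite Dc leNgt sin_neg //.
  by rewrite le_max lexx orbT gt_max Da; lra.
have [|c _ Dc] := @IVT R D a b (Num.min (D a) (3 / 2 * pi)) ab cD'.
  have Dba : D b <= D a by lra.
  by rewrite (min_r Dba) (max_l Dba) ge_min lexx le_min Dba /= andbT; lra.
have := sD c; rewrite Dc leNgt.
have -> : Num.min (D a) (3 / 2 * pi) =
    (Num.min (D a) (3 / 2 * pi) - pi) + pi by lra.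
rewrite sinDpi oppr_lt0 sin_gt0_pi //; have [m|m] := leP (D a) (3 / 2 * pi); lra.
Qed.

(* With [e] small, the argument of the quotient [q / f] is continuous along the
   horizontal line at height [e], lies in [0, pi] modulo [2 * pi], is small far
   to the right, and is close to [pi] times the difference of the counts. *)
Lemma count_gt_interlace (R : realType) (b c : R) (s t : seq R) (x : R) :
  0 < b -> 0 < c ->
  (forall z : R[i], 0 < complex.Im z ->
    0 <= cross (ceval z (c *: \prod_(a <- t) ('X - a%:P)))
               (ceval z (b *: \prod_(a <- s) ('X - a%:P)))) ->
  x \notin s ++ t ->
  (count (> x) s <= count (> x) t <= (count (> x) s).+1)%N.
Proof.
move=> b0 c0 H; rewrite mem_cat negb_or => /andP[xs xt].
have pi0 := @pi_gt0 R.
(* The point [y] lies to the right of [x] and of all zeros, so both counts vanish there. *)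
pose y := 1 + `|x| + \sum_(a <- s ++ t) `|a|.
have sum0 (r : seq R) : 0 <= \sum_(a <- r) `|a| by rewrite sumr_ge0.
have xy : x <= y.
  by have := ler_norm x; have := sum0 (s ++ t); rewrite /y; lra.
have lt_y a : a \in s ++ t -> a < y.
  move=> ast; rewrite /y (big_rem a) //=.
  have := sum0 (rem a (s ++ t)); have := ler_norm a; have := normr_ge0 x; lra.
have y_out r : {subset r <= s ++ t} -> y \notin r /\ count (> y) r = 0%N.
  move=> rst; split; first by apply/negP => /rst/lt_y; rewrite ltxx.
  rewrite (eq_in_count (a2 := pred0)) ?count_pred0 // => a /rst/lt_y ya /=.
  by rewrite ltNge ltW.
have [|ys ys0] := y_out s; first by move=> a; rewrite mem_cat => ->.
have [|yt yt0] := y_out t; first by move=> a; rewrite mem_cat orbC => ->.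
(* Two errors below [pi / 4] keep the difference of the angle sums within [pi / 2] of its limit. At
   [y] this selects the strip; at [x] it pins down the integer difference of the counts. *)
have d0 : 0 < pi / 4 :> R by lra.
have [e1 e10 h1] := angle_sum_limit xs d0.
have [e2 e20 h2] := angle_sum_limit xt d0.
have [e3 e30 h3] := angle_sum_limit ys d0.
have [e4 e40 h4] := angle_sum_limit yt d0.
pose e := Num.min (Num.min e1 e2) (Num.min e3 e4) / 2.
have m0 : 0 < Num.min (Num.min e1 e2) (Num.min e3 e4).
  by rewrite !lt_min e10 e20 e30.
have e0 : 0 < e by rewrite divr_gt0.
have /andP[/andP[ee1 ee2] /andP[ee3 ee4]] :
    ((e < e1) && (e < e2)) && ((e < e3) && (e < e4)).
  by rewrite -!lt_min /e ltr_pdivrMr // mulr_natr mulr2n ltrDl.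
have {}h1 := h1 e; have {}h2 := h2 e; have {}h3 := h3 e; have {}h4 := h4 e.
rewrite e0 ee1 in h1; rewrite e0 ee2 in h2.
rewrite e0 ee3 in h3; rewrite e0 ee4 in h4.
have {h1} := h1 isT; have {h2} := h2 isT; have {h3} := h3 isT; have {h4} := h4 isT.
rewrite ys0 yt0 mulr0 !subr0 !ltr_norml.
move=> /andP[h4 h4'] /andP[h3 h3'] /andP[h2 h2'] /andP[h1 h1'].
have /andP[] : 0 <= angle_sum e t x - angle_sum e s x <= pi.
  apply: (@sin_ge0_strip R (fun w => angle_sum e t w - angle_sum e s w) x y) => //.
  - by move=> w; apply: cvgB; exact: continuous_angle_sum.
  - move=> w; have := H (Complex w e) e0.
    have [r r0 ->] := ceval_polar w t e0 c0.
    have [r' r'0 ->] := ceval_polar w s e0 b0.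
    rewrite /cross /= (_ : _ - _ = r * r' *
        sin (angle_sum e t w - angle_sum e s w)).
      by rewrite pmulr_rge0 // mulr_gt0.
    by rewrite sinB; ring.
  by rewrite ltr_norml; lra.
(* Now [pi * (k - m)] lies strictly between [- pi / 2] and [3 pi / 2], which leaves only [k - m = 0]
   or [1]. *)
set m := count _ s in h1 h1' *; set k := count _ t in h2 h2' *.
move=> g1 g2; apply/andP; split; rewrite leqNgt; apply/negP => mk.
  have : k%:R + 1 <= m%:R :> R by rewrite natr1 ler_nat.
  by nra.
have : m%:R + 2 <= k%:R :> R by rewrite -natrD ler_nat addn2.
by nra.
Qed.

Lemma count_lt_gt (R : realType) (s : seq R) x : x \notin s ->
  (count (< x)%R s + count (> x)%R s = size s)%N.
Proof.
move=> xs; rewrite -(count_predC (< x)%R s); congr (_ + _)%N.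
apply: eq_in_count => a as_ /=; rewrite -leNgt lt_neqAle andb_idl // => _.
by apply: contraNneq xs => ->.
Qed.

Lemma exists_lt_all (R : realType) (s : seq R) :
  exists x, forall a, a \in s -> x < a.
Proof.
exists (- (1 + \sum_(a <- s) `|a|)) => a as_; rewrite (big_rem a) //=.
have : 0 <= \sum_(b <- rem a s) `|b| by rewrite sumr_ge0.
by have := ler_norm (- a); rewrite normrN; lra.
Qed.

(** Angles control the zeros to the right of a point, whereas [separates_count] needs those to the
    left. Complementing the counts exchanges the roles of [f] and [q] or not, according to whether
    the degrees agree or differ by one. *)
Lemma prec_of_upper (R : realType) (f q : {poly R}) :
  upper_nonvanishing f -> upper_nonvanishing q ->
  0 < lead_coef f -> 0 < lead_coef q ->
  (forall z : R[i], 0 < complex.Im z -> 0 <= cross (ceval z q) (ceval z f)) ->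
  prec f q.
Proof.
move=> uf uq lf lq fq; split; [exact: upper_nonvanishing_real_rooted..|].
apply: Or33; split; last by move=> x; exact: cross_wronskian.
have [s fE] := upper_nonvanishing_split uf.
have [t qE] := upper_nonvanishing_split uq.
have /permP zs := zeros_split (lt0r_neq0 lf) fE.
have /permP zt := zeros_split (lt0r_neq0 lq) qE.
have C x : x \notin s ++ t ->
    (count (> x) s <= count (> x) t <= (count (> x) s).+1)%N.
  apply: (@count_gt_interlace R (lead_coef f) (lead_coef q)) => // z z0.
  by rewrite -fE -qE; exact: fq.
(* To the left of all zeros the counts become the degrees, so the degree of [q] equals that of [f]
   or exceeds it by one. *)
have [x0 lt_x0] := exists_lt_all (s ++ t).
have all_gt r : {subset r <= s ++ t} -> count (> x0) r = size r.
  by move=> rst; apply/eqP; rewrite -all_count; apply/allP => a /rst/lt_x0.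
have x0_out : x0 \notin s ++ t by apply/negP => /lt_x0; rewrite ltxx.
have := C x0 x0_out; rewrite !all_gt; first last.
- by move=> a; rewrite mem_cat => ->.
- by move=> a; rewrite mem_cat orbC => ->.
move=> /andP[st ts].
have count_lt x : x \notin s ++ t ->
    [&& (count (< x) (zeros f) + count (> x) s == size s)%N,
    (count (< x) (zeros q) + count (> x) t == size t)%N,
    (count (> x) s <= count (> x) t)%N & (count (> x) t <= (count (> x) s).+1)%N].
  move=> xst; have := C x xst; rewrite zs zt; move: xst.
  rewrite mem_cat negb_or => /andP[/count_lt_gt-> /count_lt_gt->].
  by rewrite !eqxx.
have eq_size (a b m k S T : nat) : (a + m = S)%N -> (b + k = T)%N ->
    (m <= k)%N -> (k <= m.+1)%N -> (T <= S)%N -> (S <= T)%N ->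
    (b <= a <= b.+1)%N.
  by clear; lia.
have neq_size (a b m k S T : nat) : (a + m = S)%N -> (b + k = T)%N ->
    (m <= k)%N -> (k <= m.+1)%N -> (S < T)%N -> (T <= S.+1)%N ->
    (a <= b <= a.+1)%N.
  by clear; lia.
have [szst|szst] := leqP (size t) (size s).
  apply: (@separates_count R (s ++ t)); rewrite ?sorted_zeros // => x.
  by move=> /count_lt /and4P[/eqP h1 /eqP h2 h3 h4];
    exact: eq_size h1 h2 h3 h4 szst st.
rewrite /interlace and_comm.
apply: (@separates_count R (s ++ t)); rewrite ?sorted_zeros // => x.
by move=> /count_lt /and4P[/eqP h1 /eqP h2 h3 h4];
  exact: neq_size h1 h2 h3 h4 szst ts.
Qed.

(** * Alternatingly increasing coefficients *)

(** The chain is cut into its two kinds of links, [h_i <= h_(n-i)] and [h_(n-i) <= h_(i+1)], which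
    makes it easy to add polynomials and to compare coefficients in the induction. *)
Definition alt_increasing (R : realType) n (h : {poly R}) :=
  [/\ (size h <= n.+1)%N, 0 <= h`_0,
      forall i, (i.*2 < n)%N -> h`_i <= h`_(n - i) &
      forall i, (i.*2.+1 < n)%N -> h`_(n - i) <= h`_i.+1].

Lemma alt_increasingP (R : realType) n (h : {poly R}) :
  alt_increasing n h -> alternatingly_increasing n h.
Proof.
move=> [sh h0 h1 h2]; split=> //; apply/(pathP 0) => j.
rewrite -/(mkseq _ n.+1) size_mkseq => jn; rewrite nth_mkseq //.
case: j jn => [|j] jn //=; rewrite -/(mkseq _ n.+1) nth_mkseq ?(ltnW jn) //.
have je := odd_double_half j; case: ifP => jo; rewrite jo /= in je *.
  by rewrite uphalf_half jo add1n; apply: h2; lia.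
by rewrite uphalf_half jo; apply: h1; lia.
Qed.

Lemma alt_increasing0 (R : realType) n : alt_increasing n (0 : {poly R}).
Proof. by split=> [||i _|i _]; rewrite ?size_poly0 ?coef0. Qed.

Lemma alt_increasingD (R : realType) n (g h : {poly R}) :
  alt_increasing n g -> alt_increasing n h -> alt_increasing n (g + h).
Proof.
move=> [sg g0 g1 g2] [sh h0 h1 h2]; split; rewrite ?coefD ?addr_ge0 //.
- by rewrite (leq_trans (size_polyD _ _)) // geq_max sg.
- by move=> i i2; rewrite !coefD lerD ?g1 ?h1.
by move=> i i2; rewrite !coefD lerD ?g2 ?h2.
Qed.

Lemma alt_increasingZ (R : realType) n a (h : {poly R}) : 0 <= a ->
  alt_increasing n h -> alt_increasing n (a *: h).
Proof.
move=> a0 [sh h0 h1 h2]; split; rewrite ?coefZ ?mulr_ge0 //.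
- by rewrite (leq_trans (size_scale_leq _ _)).
- by move=> i i2; rewrite !coefZ ler_wpM2l ?h1.
by move=> i i2; rewrite !coefZ ler_wpM2l ?h2.
Qed.

(** By the coefficient recurrence, each link for the new polynomial is a nonnegative combination of
    differences of coefficients of [w] that the old chain makes nonnegative. *)
Lemma alt_increasing_step (R : realType) n (b c : R) (w : {poly R}) :
  0 <= c -> 2 * c <= b ->
  alt_increasing n w -> alt_increasing n.+1 (step_poly n.+1 b c w).
Proof.
move=> c0 cb [sw w0 w1 w2].
have b0 : 0 <= b by lra.
have wn j : (n < j)%N -> w`_j = 0.
  by move=> nj; rewrite nth_default // (leq_trans sw).
have Xw j : ('X * w)`_j.+1 = w`_j by rewrite coefXM.
have Xw0 : ('X * w)`_0 = 0 by rewrite coefXM.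
(* The links are extended to the boundary and middle indices: a coefficient beyond degree [n] or
   before index 0 counts as 0, and in the middle both sides coincide. *)
have w1' i : (i.*2 <= n)%N -> w`_i <= w`_(n - i).
  rewrite leq_eqVlt => /predU1P[ni|]; last exact: w1.
  by rewrite (_ : n - i = i)%N //; lia.
have w2' i : (i.*2 <= n.+1)%N -> w`_(n.+1 - i) <= w`_i.
  case: i => [_|i i2]; first by rewrite subn0 wn.
  have [i2'|i2'] := leqP i.*2.+2 n; first exact: w2.
  by rewrite subSS (_ : n - i = i.+1)%N //; lia.
have w2X i : (i.*2 <= n.+1)%N -> ('X * w)`_i <= w`_(n.+1 - i).
  case: i => [_|i i2]; first by rewrite subn0 wn // Xw0.
  by rewrite Xw subSS w1'; lia.
have natB i j : (i <= j)%N -> (j - i)%:R = j%:R - i%:R :> R.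
  by move=> ij; rewrite natrB.
split.
- apply/leq_sizeP => -[|j] //; rewrite ltnS => nj.
  by rewrite coef_step_poly Xw (wn j.+1) 1?ltnW // wn //; ring.
- by rewrite coef_step_poly Xw0 !mulr0 addr0 add0r mulr_ge0.
- move=> i i2; rewrite !coef_step_poly.
  have -> : ('X * w)`_(n.+1 - i) = w`_(n - i) by rewrite subSn ?Xw //; lia.
  have in1 : i%:R + 1 <= n.+1%:R :> R by rewrite natr1 ler_nat; lia.
  have iR : 0 <= i%:R :> R by [].
  have h1 : w`_i <= w`_(n - i) by apply: w1'; lia.
  have h2 : ('X * w)`_i <= w`_(n.+1 - i) by apply: w2X; lia.
  have h3 : w`_(n.+1 - i) <= w`_i by apply: w2'; lia.
  rewrite natB; last by lia.
  rewrite -[n.+2%:R]natr1.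
  set N := n.+1%:R in in1 *; set I := i%:R in in1 iR *.
  (* The factor [b - 2 * c] in this regrouping is what the hypothesis [2 * c <= b] is for. *)
  rewrite -subr_ge0 (_ : _ - _ = (b * I + c) * (w`_(n - i) - w`_i) +
    (b * (N - I) + c) * (w`_(n.+1 - i) - ('X * w)`_i) +
    (b - 2 * c) * (w`_(n - i) - ('X * w)`_i)); last by ring.
  have bI : 0 <= b * I by rewrite mulr_ge0.
  have bN : 0 <= b * (N - I) by rewrite mulr_ge0 //; lra.
  by rewrite addr_ge0 ?addr_ge0 ?mulr_ge0 //; lra.
move=> i i2; rewrite !coef_step_poly.
have -> : ('X * w)`_(n.+1 - i) = w`_(n - i) by rewrite subSn ?Xw //; lia.
rewrite Xw.
have in1 : i%:R + 1 <= n.+1%:R :> R by rewrite natr1 ler_nat; lia.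
have iR : 0 <= i%:R :> R by [].
have h1 : w`_(n - i) <= w`_i.+1 by have := w2' i.+1; rewrite subSS; apply; lia.
have h2 : w`_(n.+1 - i) <= w`_i by apply: w2'; lia.
have h3 : w`_i <= w`_(n - i) by apply: w1'; lia.
rewrite natB; last by lia.
rewrite -[n.+2%:R]natr1 -[i.+1%:R]natr1.
set N := n.+1%:R in in1 *; set I := i%:R in in1 iR *.
rewrite -subr_ge0 (_ : _ - _ = (b * (I + 1) - c) * (w`_i.+1 - w`_(n - i)) +
  (b * (N - I) - c) * (w`_i - w`_(n.+1 - i)) +
  2 * c * (w`_i.+1 - w`_(n.+1 - i))); last by ring.
have bI : 0 <= b * I by rewrite mulr_ge0.
have bN : 0 <= b * (N - I - 1) by rewrite mulr_ge0 //; lra.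
by rewrite addr_ge0 ?addr_ge0 ?mulr_ge0 //; lra.
Qed.

(** Passing from [n] to [n + 1] multiplies the sequence by [r m] when [k = n + 1] and by [r m + 1]
    otherwise. These are steps with [b = r] and [c] equal to 0 or 1, so [2 * c <= b] follows from
    [r >= 2]. *)
Lemma is_A_alt_increasing (R : realType) n r k (A : {poly R}) :
  (2 <= r)%N -> (k <= n)%N -> is_A n r k A -> alt_increasing n A.
Proof.
move=> r2 kn hA; suff : exists2 h : {poly R}, is_A n r k h & alt_increasing n h.
  by case=> h hh; rewrite (gf_numerator_inj hA hh).
have r2R : 2 <= r%:R :> R by rewrite ler_nat.
elim: n k kn {A hA} => [|n IH] k kn.
  exists 1; last by split; rewrite ?size_poly1 ?coefC ?ler01.
  move: kn; rewrite leqn0 => /eqP->.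
  refine (eq_gf_numerator _ (gf_refined_eulerian R (leqnn 0))) => m.
  by rewrite subnn !expr0.
move: kn; rewrite leq_eqVlt => /predU1P[->|kn].
  have [h hh ai] := IH n (leqnn n).
  exists (step_poly n.+1 r%:R 0 h); last by apply: alt_increasing_step => //; lra.
  refine (eq_gf_numerator _ (gf_numerator_step r%:R 0 hh)) => m.
  by rewrite !subnn !expr0 exprS natrM; ring.
have [h hh ai] := IH k kn.
exists (step_poly n.+1 r%:R 1 h); last by apply: alt_increasing_step => //; lra.
refine (eq_gf_numerator _ (gf_numerator_step r%:R 1 hh)) => m.
by rewrite subSn // exprS natrD natrM; ring.
Qed.

(** * Weights in the refined Eulerian basis and their minors *)

(** The lower index [n - j] makes the binomial vanish for [j < k <= n]; with [j - k] the truncated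
    subtraction would give 1 there. *)
Definition veronese_weight (R : realType) n r k j : R :=
  (r ^ k * r.-1 ^ (j - k) * 'C(n - k, n - j))%:R.

Lemma is_A_refined_eulerian (R : realType) n r k (A : {poly R}) :
  (0 < r)%N -> (k <= n)%N -> is_A n r k A ->
  A = \sum_(0 <= j < n.+1) veronese_weight R n r k j *: refined_eulerian R n j.
Proof.
move=> r0 kn hA; apply: gf_numerator_inj hA _.
rewrite big_mkord.
have := @gf_numerator_sum R _ (index_enum 'I_n.+1)
  (fun j => veronese_weight R n r k j) _ n.+1 _
  (fun j => gf_refined_eulerian R (leq_ord j)).
apply: eq_gf_numerator => m.
rewrite -(big_mkord xpredT (fun j => veronese_weight R n r k j *
  (m%:R ^+ j * (m + 1)%:R ^+ (n - j)))).
rewrite (big_cat_nat (n := k)) //=; last exact: leqW.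
rewrite big_nat big1 ?add0r => [|j /andP[_ jk]]; last first.
  by rewrite /veronese_weight bin_small ?muln0 ?mul0r //; lia.
rewrite -{1}[k]add0n big_addn subSn // big_mkord.
have -> : (r * m + 1)%:R = (m + 1)%:R + r.-1%:R * m%:R :> R.
  rewrite -natrM -natrD; congr (_%:R).
  by case: r r0 => // r _; rewrite /= mulSn; lia.
rewrite exprDn mulr_sumr; apply: eq_bigr => i _.
rewrite /veronese_weight addnK -bin_sub; last by have := ltn_ord i; lia.
rewrite (_ : n - k - (n - (i + k)) = i)%N; last by have := ltn_ord i; lia.
rewrite (_ : n - (i + k) = n - k - i)%N; last by lia.
rewrite -mulr_natr !natrM !natrX !exprMn exprD; ring.
Qed.

(** The ratio of ['C(a, i)] to ['C(n, i)] decreases in [i]: one step multiplies it by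
    [(a - i) / (n - i)], which is at most 1. *)
Lemma bin_ratio (a n i j : nat) : (a <= n)%N -> (i <= j)%N ->
  ('C(a, j) * 'C(n, i) <= 'C(a, i) * 'C(n, j))%N.
Proof.
move=> an /subnKC <-; elim: (j - i)%N => [|d IH]; first by rewrite addn0 mulnC.
rewrite addnS -(leq_pmul2l (ltn0Sn (i + d))) mulnA mul_bin_left mulnCA mul_bin_left.
by rewrite -mulnA [leqRHS]mulnCA leq_mul // leq_sub2r.
Qed.

(** Comparing both [a] and [b] with [n] through [bin_ratio] and multiplying, the symmetry of
    ['C(n, _)] produces the common factor ['C(n, i) * 'C(n, j)], which cancels. *)
Lemma bin_minor (a b n i j : nat) :
  (a <= n)%N -> (b <= n)%N -> (i <= j)%N -> (j <= n)%N ->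
  ('C(a, j) * 'C(b, n - i) <= 'C(a, i) * 'C(b, n - j))%N.
Proof.
move=> an bn ij jn.
have h1 := bin_ratio an ij.
have h2 : ('C(b, n - i) * 'C(n, n - j) <= 'C(b, n - j) * 'C(n, n - i))%N.
  by apply: bin_ratio; lia.
rewrite !bin_sub // in h2; last by lia.
rewrite -(leq_pmul2r (_ : 0 < 'C(n, i) * 'C(n, j))%N).
  by rewrite mulnACA [X in (_ <= _ * X)%N]mulnC [leqRHS]mulnACA leq_mul.
by rewrite muln_gt0 !bin_gt0 jn (leq_trans ij).
Qed.

(** Two parameter pairs are needed because the minors for a sum expand bilinearly. The powers
    compare since [r - 1] and [s - 1] are at least 1 and their exponents grow; the binomials are
    handled by [bin_minor]. *)
Lemma veronese_weight_minor (R : realType) (n r k s l i j : nat) :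
  (2 <= r)%N -> (2 <= s)%N -> (k <= n)%N -> (l <= n)%N ->
  (i <= j)%N -> (j <= n)%N ->
  veronese_weight R n r k (n - j) * veronese_weight R n s l i <=
  veronese_weight R n r k (n - i) * veronese_weight R n s l j.
Proof.
move=> r2 s2 kn ln ij jn; rewrite /veronese_weight -!natrM ler_nat !subKn //;
  last by lia.
rewrite mulnACA [leqRHS]mulnACA leq_mul ?bin_minor ?leq_subr //.
rewrite leq_mul // leq_mul // leq_pexp2l //; lia.
Qed.

Lemma ler_sum_mul (R : realType) a b c d (F F' G G' : nat -> R) :
  (forall i j, (a <= i < b)%N -> (c <= j < d)%N -> F i * G j <= F' i * G' j) ->
  (\sum_(a <= i < b) F i) * (\sum_(c <= j < d) G j) <=
  (\sum_(a <= i < b) F' i) * (\sum_(c <= j < d) G' j).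
Proof.
move=> H; rewrite !mulr_suml; apply: ler_sum_nat => i iab.
by rewrite !mulr_sumr; apply: ler_sum_nat => j jcd; exact: H.
Qed.

Theorem theorem3p1 (R : realType) (n : nat) (hn : (1 <= n)%N)
    (A : nat -> nat -> {poly R})
    (hA : forall r k : nat, (2 <= r)%N -> (k <= n)%N -> is_A n r k (A r k))
    (c : nat -> nat -> R)
    (c_ge0 : forall r k : nat, (2 <= r)%N -> (k <= n)%N -> 0 <= c r k)
    (N : nat)
    (c_fin : forall r k : nat, (N <= r)%N -> (k <= n)%N -> c r k = 0)
    (p : {poly R})
    (hp : p = \sum_(2 <= r < N) \sum_(0 <= k < n.+1) c r k *: A r k) :
  [/\ prec (inv_poly n p) p, real_rooted p & alternatingly_increasing n p].
Proof.
have ai : alt_increasing n p.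
  have ai0 := alt_increasing0 R n; have aiD := @alt_increasingD R n.
  rewrite hp big_nat_cond; apply: (big_ind (alt_increasing n)) => //.
  move=> r /andP[/andP[r2 _] _].
  rewrite big_nat_cond; apply: (big_ind (alt_increasing n)) => //.
  move=> k /andP[/andP[_ kn] _].
  apply: alt_increasingZ; first exact: c_ge0.
  exact: is_A_alt_increasing (hA r k _ _).
suff [pr rr] : prec (inv_poly n p) p /\ real_rooted p.
  by split=> //; exact: alt_increasingP.
(* The zero polynomial vanishes in the upper half plane and is covered by the convention in
   [prec]. *)
have [p0|p_neq0] := eqVneq p 0.
  have inv0 : inv_poly n p = 0.
    by apply/polyP=> j; rewrite coef_inv_poly p0 !coef0; case: ifP.
  by split; [split; [left| left|apply: Or31] | left].
pose w j :=
  \sum_(2 <= r < N) \sum_(0 <= k < n.+1) c r k * veronese_weight R n r k j.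
have w_ge0 j : 0 <= w j.
  rewrite /w big_nat_cond sumr_ge0 // => r /andP[/andP[r2 _] _].
  rewrite big_nat_cond sumr_ge0 // => k /andP[/andP[_ kn] _].
  by rewrite mulr_ge0 ?c_ge0.
have pE : p = \sum_(0 <= j < n.+1) w j *: refined_eulerian R n j.
  under eq_bigr do rewrite /w scaler_suml.
  rewrite exchange_big /= hp; apply: eq_big_nat => r /andP[r2 _].
  under eq_bigr do rewrite scaler_suml.
  rewrite exchange_big /=; apply: eq_big_nat => k /andP[_]; rewrite ltnS => kn.
  rewrite {1}(is_A_refined_eulerian (ltnW r2) kn (hA r k r2 kn)) scaler_sumr.
  by apply: eq_bigr => j _; rewrite scalerA.
have invE : inv_poly n p =
    \sum_(0 <= j < n.+1) w (n - j)%N *: refined_eulerian R n j.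
  rewrite pE inv_poly_sum big_nat_rev /=; apply: eq_big_nat => j /andP[_ jn].
  by rewrite add0n subSS inv_refined_eulerian ?leq_subr ?subKn.
(* Both products expand over two pairs [(r, k)] and [(s, l)]; each summand carries the same
   nonnegative factor [c r k * c s l] on both sides. *)
have minor i j : (i < j)%N -> (j <= n)%N -> w (n - j)%N * w i <= w (n - i)%N * w j.
  move=> ij jn; apply: ler_sum_mul => r s /andP[r2 _] /andP[s2 _].
  apply: ler_sum_mul => k l /andP[_ kn] /andP[_ ln].
  rewrite mulrACA [leRHS]mulrACA ler_wpM2l ?mulr_ge0 ?c_ge0 //.
  by apply: veronese_weight_minor => //; exact: ltnW.
have [j0 j0n wj0] : exists2 j, (j <= n)%N & w j != 0.
  have [/existsP[j wj]|/existsPn w0] := boolP [exists j : 'I_n.+1, w j != 0].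
    by exists j; rewrite // -ltnS.
  case/eqP: p_neq0; rewrite pE big_mkord big1 // => j _.
  by have := w0 j; rewrite negbK => /eqP->; rewrite scale0r.
have ev (v : nat -> R) z :
    ceval z (\sum_(0 <= j < n.+1) v j *: refined_eulerian R n j) =
    \sum_(0 <= j < n.+1) (v j)%:C%C * ceval z (refined_eulerian R n j).
  by rewrite ceval_sum; apply: eq_bigr => j _; rewrite cevalZ.
have up : upper_nonvanishing p.
  move=> z z0; rewrite pE ev.
  apply: (cone_neq0 z0 (fan_refined_eulerian n z0)) => //.
  by exists j0.
have ui : upper_nonvanishing (inv_poly n p).
  move=> z z0; rewrite invE ev.
  apply: (cone_neq0 (w := fun j => w (n - j)%N) z0
    (fan_refined_eulerian n z0)) => //.
  by exists (n - j0)%N; rewrite ?leq_subr ?subKn.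
(* All coefficients of the basis polynomials are nonnegative, so a nonzero nonnegative combination
   has positive leading coefficient. *)
have lead_gt0 (v : nat -> R) : (forall j, 0 <= v j) ->
    \sum_(0 <= j < n.+1) v j *: refined_eulerian R n j != 0 ->
    0 < lead_coef (\sum_(0 <= j < n.+1) v j *: refined_eulerian R n j).
  move=> v0 q0; rewrite lt_neqAle eq_sym lead_coef_eq0 q0 /= lead_coefE coef_sum.
  by apply: sumr_ge0 => j _; rewrite coefZ mulr_ge0 ?refined_eulerian_ge0.
split; last exact: upper_nonvanishing_real_rooted.
apply: prec_of_upper => //.
- rewrite invE; apply: lead_gt0 => //; rewrite -invE.
  exact: upper_nonvanishing_neq0.
- by rewrite pE; apply: lead_gt0 => //; rewrite -pE.
move=> z z0; rewrite invE {1}pE !ev.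
apply: (cross_cone_ge0 (v := fun j => w (n - j)%N) (fan_refined_eulerian n z0)).
exact: minor.
Qed.
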